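(* Let $G$ be a median graph and $v_0$ a vertex of $G$. For any LexBFS ordering of the vertices of $G$ started at $v_0$, with parent map $f$, and for any edge $uv$ of $G$ with $v_0\notin\{u,v\}$, the parents $f(u)$ and $f(v)$ are adjacent.
   Context: All graphs are finite, simple, connected and undirected; $d(u,v)$ is the shortest-path distance and $I(u,v)=\{x: d(u,x)+d(x,v)=d(u,v)\}$. $G$ is a median graph if for every triple $x,y,z$ of vertices $I(x,y)\cap I(y,z)\cap I(z,x)$ is a single vertex. Breadth-first search (BFS) from $v_0$ uses a queue; it defines a total order $<$ on vertices (order of insertion into the queue); when a vertex $u$ is removed from the head of the queue, all its not yet discovered neighbors $v$ are inserted and $u$ becomes the parent $f(v)$ of $v$. For $v\neq v_0$, the predecessors of $v$ are its neighbors $u$ with $d(v_0,u)<d(v_0,v)$, and $f(v)$ is the $<$-smallest predecessor. Lexicographic BFS (LexBFS) is the refinement of BFS in which ties among vertices are broken as follows: the list of already-ordered neighbors (predecessors) of each vertex is sorted by $<$, and a vertex is visited earlier than another if its sorted predecessor list is lexicographically smaller (comparing earliest predecessors first, then second-earliest, etc., where a vertex having an additional predecessor at the first position where the lists differ—the other list having ended—is chosen first). A LexBFS ordering is the resulting total order $<$ with its parent map $f$. *)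

(* Defs.v *)
From mathcomp Require Import all_boot.

Set Implicit Arguments.
Unset Strict Implicit.
Unset Printing Implicit Defensive.

(* A simple graph on the vertex set T : finType is a symmetric irreflexive
   relation e : rel T. *)

Section Graph.
Variables (T : finType) (e : rel T).

Definition connected_graph := forall x y : T, connect e x y.

Definition has_walk (x y : T) (n : nat) : bool :=
  [exists p : n.-tuple T, path e x p && (last x p == y)].

(* The least length of a walk from x to y.  In a connected graph this length is
   smaller than #|T|; the junk value for unreachable y is #|T|. *)
Definition dist (x y : T) : nat := find (has_walk x y) (iota 0 #|T|).

Definition interval (u v : T) : {set T} :=
  [set x | dist u x + dist x v == dist u v].

Definition median_graph :=
  forall x y z : T, #|interval x y :&: interval y z :&: interval z x| = 1.

(* A total order on (part of) the vertices is a duplicate-free sequence s, with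
   x < y iff x occurs before y. Vertices are compared by their index in s, and
   filtering s lists the already ordered neighbors of v in increasing order. *)
Definition ordered_neighbors (s : seq T) (v : T) : seq nat :=
  [seq index w s | w <- s & e w v].

(* Lexicographic comparison in which a proper extension of a list comes before
   that list (the opposite of the dictionary convention). *)
Fixpoint lex_le (a b : seq nat) : bool :=
  match a, b with
  | _, [::] => true
  | [::], _ :: _ => false
  | i :: a', j :: b' => (i < j) || ((i == j) && lex_le a' b')
  end.

(* After s has been ordered, the vertices of c may be ordered next, in the order
   in which they are listed: each one is lexicographically first among those of
   c that remain. Vertices with equal lists may come in any order. *)
Fixpoint lex_visit (s c : seq T) : bool :=
  if c is v :: c' then
    all (fun w => lex_le (ordered_neighbors s v) (ordered_neighbors s w)) c'
      && lex_visit (rcons s v) c'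
  else true.

(* lexbfs_state v0 q s f: some run of LexBFS from v0 reaches the queue q (head
   first), the insertion order s and the parent map f. The value f v is
   arbitrary for v = v0 and for v not yet inserted. *)
Inductive lexbfs_state (v0 : T) : seq T -> seq T -> {ffun T -> T} -> Prop :=
| LexBFSStart (f : {ffun T -> T}) : lexbfs_state v0 [:: v0] [:: v0] f
| LexBFSDequeue (u : T) (q s c : seq T) (f : {ffun T -> T}) :
    lexbfs_state v0 (u :: q) s f ->
    perm_eq c (enum [pred v | e u v & v \notin s]) ->
    lex_visit s c ->
    lexbfs_state v0 (q ++ c) (s ++ c) [ffun v => if v \in c then u else f v].

Definition lexbfs_ordering (v0 : T) (s : seq T) (f : {ffun T -> T}) : Prop :=
  lexbfs_state v0 [::] s f.

End Graph.

(* Main.v *)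
(** Write [a <| b] when [ab] is an edge and [b] is one step further from [v0].
    By induction on the level of [p] we show that [q <| p] implies
    [f q <| f p].  Let [v = f u], [v' <| u], [w = f v'], [w'' = f v], let
    [w'] be the common lower neighbor of [v] and [v'], and suppose that [w] is
    not below [v].  Then [w], [w'], [w''] are the atoms of a cube with
    bottom [x] and top [u]; its last vertex [m] covers [w] and [w''].  By
    induction [w] and [w'] are siblings with [w < w'], while [v] and [m]
    are siblings with [v < m], although the second predecessors [w'] of [v] and
    [w] of [m] suggest the opposite order.  LexBFS explains [v < m] by an
    extra predecessor [z] of [v] and [w < w'] by an extra predecessor [a] of
    [w].  The parallel edges [v z] and [w a] turn out to be dual to the same
    hyperplane (this uses the coherence of the order on parallel edges), and
    moving along it gives the same configuration one level lower. *)
Require Import Defs.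
From mathcomp Require Import all_boot.
From mathcomp Require Import zify.

Set Implicit Arguments.
Unset Strict Implicit.
Unset Printing Implicit Defensive.

(* [lia] becomes very slow when boolean hypotheses other than inequalities are
   in the context. *)
Ltac order_lia :=
  repeat match goal with
  | H : ?P |- _ =>
    lazymatch P with
    | is_true (leq _ _) => fail
    | @eq nat _ _ => fail
    | _ => clear H
    end
  end; lia.

(** * Lexicographic orders on graded graphs without K_{2,3} *)

Section GradedOrder.
Variables (T : finType) (cov : rel T) (l r : T -> nat) (f : T -> T).
Hypotheses (cov_l : forall a b, cov a b -> l b = (l a).+1)
  (level0 : forall a b, l a = 0 -> l b = 0 -> a = b)
  (meet_ex : forall p q u, cov p u -> cov q u -> p <> q ->
     exists2 t, cov t p & cov t q)
  (meet_uniq : forall p q a b, cov a p -> cov a q -> cov b p -> cov b q ->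
     p <> q -> a = b)
  (noK23 : forall t v p q z, cov t p -> cov t q -> cov t z ->
     cov p v -> cov q v -> cov z v -> p <> q -> q <> z -> p <> z -> False)
  (join_ex : forall t p q p1 q1 u, cov t p -> cov t q -> p <> q ->
     cov p p1 -> cov p1 u -> cov q q1 -> cov q1 u ->
     exists m, [/\ cov p m, cov q m & cov m u])
  (r_inj : injective r)
  (f_cov : forall v, 0 < l v -> cov (f v) v)
  (f_min : forall u v, cov u v -> r (f v) <= r u)
  (f_mono : forall v w, 0 < l v -> 0 < l w -> r v <= r w -> r (f v) <= r (f w))
  (lex_second : forall v w b, 0 < l v -> 0 < l w -> f v = f w -> r v < r w ->
     cov b w -> b <> f w -> exists a, [/\ cov a v, a <> f v & r a <= r b]).

(** The induction hypothesis of the main argument, cut off at level [K] so that the auxiliary lemmas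
    may use it below the level being treated. *)
Definition parents_cover (K : nat) :=
  forall p q, l p <= K -> cov q p -> 0 < l q -> cov (f q) (f p).

Lemma cov_pos a b : cov a b -> 0 < l b.
Proof. by move/cov_l->. Qed.

Lemma level_pos a b : l a = l b -> a <> b -> 0 < l a.
Proof.
by move=> ab ne; case E: (l a) => //; case: ne; apply: level0; order_lia.
Qed.

Lemma cov_pos2 p a b : cov a p -> cov b p -> a <> b -> 0 < l a.
Proof. by move=> /cov_l ha /cov_l hb; apply: level_pos; order_lia. Qed.

Lemma r_lt a b : r a <= r b -> a <> b -> r a < r b.
Proof.
by move=> le ne; rewrite ltn_neqAle le andbT; apply/eqP => /r_inj.
Qed.

Lemma f_strict a b : 0 < l a -> 0 < l b -> r (f a) < r (f b) -> r a < r b.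
Proof.
move=> a0 b0 lt; case: (ltnP (r a) (r b)) => // /(f_mono b0 a0); order_lia.
Qed.

Lemma f_unique_min u v : cov u v -> r u <= r (f v) -> f v = u.
Proof. by move=> c le; apply: r_inj; apply/eqP; rewrite eqn_leq f_min. Qed.

(** [f a] and [t] are both below [a] and below [f p], and two distinct vertices have at most one
    common lower neighbor. *)
Lemma parents_meet K p a t : parents_cover K -> l p <= K -> cov a p ->
  a <> f p -> cov t a -> cov t (f p) -> f a = t.
Proof.
move=> FT pK ap ne ta tp.
have a0 := cov_pos ta.
by apply: (meet_uniq (f_cov a0) (FT _ _ pK ap a0) ta tp).
Qed.

(* The squares below [p] transport the order of the predecessors of [p] to the
   order of the predecessors of [x] along parallel edges. *)
Lemma meet_order K p x y c t s : parents_cover K -> l p <= K ->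
  cov x p -> cov y p -> cov c p -> x <> y -> x <> c -> y <> c ->
  cov t x -> cov t y -> cov s x -> cov s c -> r y < r c -> r t < r s.
Proof.
move=> FT; move en: (l p) => n; elim/ltn_ind: n p x y c t s en.
move=> n IH p x y c t s en pK xp yp cp xy xc yc tx ty sx sc lt.
have p0 := cov_pos xp; have qp := f_cov p0.
have pK' : l p <= K by order_lia.
have ts : t <> s.
  move=> ts; rewrite -ts in sc.
  exact: (noK23 tx ty sc xp yp cp).
have x0 := cov_pos2 xp yp xy.
have y0 := cov_pos2 yp cp yc.
have c0 := cov_pos2 cp yp (nesym yc).
have t0 := cov_pos2 tx sx ts.
have s0 := cov_pos2 sx tx (nesym ts).
have qc : f p <> c by move=> q; have := f_min yp; rewrite q; order_lia.
(* Here the parents of [y] and [c] are their meets with [x], so monotonicity of [f] decides. *)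
case: (altP (f p =P x)) => [qx|/eqP qx].
  have fy : f y = t.
    by apply: (parents_meet FT pK' yp); rewrite ?qx //; apply: nesym.
  have fc : f c = s.
    by apply: (parents_meet FT pK' cp); rewrite ?qx //; apply: nesym.
  apply: r_lt => //; rewrite -fy -fc; apply: f_mono => //; order_lia.
case: (altP (f p =P y)) => [qy|/eqP qy].
  have fx : f x = t by apply: (parents_meet FT pK' xp); rewrite ?qy.
  by apply: r_lt => //; rewrite -fx f_min.
have fxq := FT _ _ pK' xp x0; have fyq := FT _ _ pK' yp y0.
have fcq := FT _ _ pK' cp c0.
(* By [noK23], predecessors of [p] other than [f p] have distinct parents, so the whole
   configuration descends from [p] to [f p]. *)
have dist3 a b : cov a p -> cov b p -> f p <> a -> f p <> b -> a <> b ->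
    0 < l a -> 0 < l b -> f a <> f b.
  move=> ap bp qa qb ab a0 b0 E.
  have fab : cov (f a) b by rewrite E f_cov.
  by apply: (noK23 (f_cov a0) fab (FT _ _ pK' ap a0) ap bp qp); auto.
have lev0 := cov_l xp.
have lev1 := cov_l yp.
have lev2 := cov_l cp.
have lev3 := cov_l qp.
apply: f_strict => //.
apply: (IH (l (f p)) _ (f p) (f x) (f y) (f c)) => //; try order_lia; auto.
- by apply: FT => //; order_lia.
- by apply: FT => //; order_lia.
- by apply: FT => //; order_lia.
- by apply: FT => //; order_lia.
- by apply: r_lt; auto; apply: f_mono => //; order_lia.
Qed.

(* Among the hyperplanes crossed by edges going down from [x], those before one
   that precedes [x] at [p] are also crossed by an edge going down from [p]. *)
Lemma initial_direction K p x y t s : parents_cover K -> l p <= K ->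
  cov x p -> cov y p -> cov t x -> cov t y -> r y < r x ->
  cov s x -> r s < r t -> exists c, [/\ cov c p, cov s c & c <> x].
Proof.
move=> FT; move en: (l p) => n; elim/ltn_ind: n p x y t s en.
move=> n IH p x y t s en pK xp yp tx ty yx sx st.
have p0 := cov_pos xp; have qp := f_cov p0.
have pK' : l p <= K by order_lia.
have nxy : x <> y by move=> E; rewrite E in yx; order_lia.
have nst : s <> t by move=> E; rewrite E in st; order_lia.
have x0 := cov_pos2 xp yp nxy.
have y0 := cov_pos2 yp xp (nesym nxy).
have s0 := cov_pos2 sx tx nst.
have t0 := cov_pos2 tx sx (nesym nst).
have qx : x <> f p by move=> q; have := f_min yp; rewrite -q; order_lia.
case: (altP (y =P f p)) => [qy|/eqP qy].
  have fx : f x = t by apply: (parents_meet FT pK' xp) => //; rewrite -qy.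
  by have := f_min sx; rewrite fx; order_lia.
have fxq := FT _ _ pK' xp x0; have fyq := FT _ _ pK' yp y0.
case: (altP (s =P f x)) => [->|/eqP sg]; first by exists (f p); split; auto.
have fxy : f y <> f x.
  move=> E; have gy : cov (f x) y by rewrite -E f_cov.
  exact: (noK23 (f_cov x0) gy fxq xp yp qp).
have tg : t <> f x.
  move=> E; apply: fxy; apply: (parents_meet FT pK' yp) => //; by rewrite -E.
have lev0 := cov_l xp.
have lev1 := cov_l yp.
have lev2 := cov_l qp.
have fsx : cov (f s) (f x) by apply: FT => //; order_lia.
have fst_ : f s <> f t.
  move=> E.
  have fts : cov (f s) t by rewrite E f_cov.
  exact: (noK23 (f_cov s0) fts fsx sx tx (f_cov x0)).
(* The induction hypothesis at [f p] gives [c1] above [f s]; joining [c1] and [s] below [p] lifts it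
   to the required [c]. *)
have [] := IH (l (f p)) _ (f p) (f x) (f y) (f t) (f s) => //; try order_lia.
- by apply: FT => //; order_lia.
- by apply: FT => //; order_lia.
- by apply: r_lt => //; apply: f_mono => //; order_lia.
- by apply: r_lt => //; apply: f_mono => //; order_lia.
move=> c1 [c1q sc1 c1g].
have c1s : c1 <> s.
  by move=> E; apply: sg; rewrite -E in sx *; apply: (meet_uniq sx c1q (f_cov x0)).
have [c [h1 h2 h3]] := join_ex sc1 (f_cov s0) c1s c1q qp sx xp.
exists c; split=> // E; apply: c1g; rewrite E in h1.
exact: (meet_uniq h1 c1q (f_cov x0)).
Qed.

Lemma second_ex v b : cov b v -> b <> f v -> exists z,
  [/\ cov z v, z <> f v & forall a, cov a v -> a <> f v -> r z <= r a].
Proof.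
move=> bv bf; pose P a := cov a v && (a != f v).
have Pb : P b by rewrite /P bv; apply/eqP.
case: (arg_minnP r Pb) => z /andP[zv /eqP zf] zmin.
by exists z; split=> // a av /eqP af; apply: zmin; rewrite /P av.
Qed.

(* Here [p] is the vertex called [w''] in the header. *)
Lemma no_inversion K x p w w' v m : parents_cover K -> l v <= K ->
  0 < l w -> f w = x -> f w' = x -> f v = p -> f m = p ->
  cov x p -> cov x w' -> cov w' v -> cov w m -> cov p m ->
  p <> w -> p <> w' -> r w < r w' -> r v < r m -> False.
Proof.
move=> FT; move en: (l v) => n; elim/ltn_ind: n x p w w' v m en.
move=> n IH x p w w' v m en vK w0 fw fw' fv fm xp xw' w'v wm pm pw pw' ww' vm.
have vK' : l v <= K by order_lia.
have v0 := cov_pos w'v; have m0 := cov_pos wm.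
have pv : cov p v by rewrite -fv f_cov.
have xw : cov x w by rewrite -fw f_cov.
have nvm : v <> m by move=> E; rewrite E in vm; order_lia.
have only_p a : cov a v -> cov a m -> a = p.
  by move=> av am; apply: (meet_uniq av am pv pm).
have [] := @second_ex v w' w'v; first by rewrite fv; auto.
move=> z [zv zp zmin].
(* Since [v] precedes its sibling [m], its second predecessor [z] comes before every predecessor of
   [m] except [p]; equality is impossible because [v] and [m] share only [p]. *)
have zmin_m b : cov b m -> b <> p -> r z < r b.
  move=> bm bp; apply: r_lt; last first.
    by move=> E; rewrite -E in bm bp; apply: bp; apply: only_p.
  have [] := lex_second v0 m0 _ vm bm _; try by rewrite ?fv ?fm.
  move=> a [av ap ab]; have := zmin a av ap; order_lia.
rewrite fv in zp zmin.
have zw := zmin_m w wm (nesym pw).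
have zw' : z <> w' by move=> E; rewrite E in zw; order_lia.
have [y' y'z y'w'] := meet_ex zv w'v zw'.
have z0 := cov_pos y'z.
have yp : cov (f z) p by rewrite -fv; apply: FT.
have yz := f_cov z0.
have yx : f z <> x.
  move=> E; rewrite E in yz.
  by apply: (noK23 yz xp xw' zv pv w'v).
have y'x : y' <> x.
  move=> E; rewrite E in y'z; apply: yx.
  exact: (meet_uniq yz yp y'z xp).
have yy' : f z <> y'.
  move=> E; apply: yx; apply: (meet_uniq yp _ xp xw' pw').
  by rewrite E.
have xpos := cov_pos2 xp yp (nesym yx).
have ypos := cov_pos2 yp xp yx.
have y'pos := cov_pos2 y'w' xw' y'x.
have w'0 := cov_pos xw'.
have lev0 := cov_l w'v.
have lev1 := cov_l wm.
have lev2 := cov_l pm.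
have lev3 := cov_l pv.
have lev4 := cov_l zv.
have lev5 := cov_l xw.
have lev6 := cov_l xw'.
have lev7 := cov_l yz.
have ylx : r (f z) < r x.
  by apply: r_lt => //; rewrite -fw; apply: f_mono => //; order_lia.
(* The same comparison for the siblings [w] and [w']: the predecessor [y'] of [w'] forces an extra
   predecessor [a] of [w], with [a] before [y']. *)
have [] := lex_second w0 w'0 _ ww' y'w' _; try by rewrite ?fw ?fw'.
move=> a0 [a0w a0x a0y'].
have [a [aw ax amin]] := second_ex a0w a0x.
have ay' : r a < r y'.
  have := amin _ a0w a0x => ?.
  apply: r_lt; first order_lia.
  move=> E; apply: ax; rewrite E fw in aw *.
  by apply: (meet_uniq y'w' aw xw' xw) => E'; rewrite E' in ww'; order_lia.
rewrite fw in ax {amin}.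
have apos := cov_pos2 aw xw ax.
have ap : ~ cov a p.
  by move=> ap; apply: ax; apply: (meet_uniq aw ap xw xp (nesym pw)).
have tx : cov (f y') x by rewrite -fw'; apply: FT => //; order_lia.
have ty : cov (f y') (f z) by apply: FT => //; order_lia.
have sx : cov (f a) x by rewrite -fw; apply: FT => //; order_lia.
(* Given this equality, the edges [z v] and [a w] are both parallel to the edge from [f y'] to [x].
   If it failed, [f a] would precede [f y'], and [initial_direction] would give another predecessor
   [c0] of [p] above [f a]. *)
have st : f a = f y'.
  apply/eqP; apply/negPn; apply/negP => /eqP ne.
  have lt : r (f a) < r (f y').
    by apply: r_lt => //; apply: f_mono => //; order_lia.
  have pK : l p <= K by order_lia.
  have [c0 [c0p sc0 c0x]] := initial_direction FT pK xp yp tx ty ylx sx lt.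
  have c0a : c0 <> a by move=> E; apply: ap; rewrite -E.
  have [c [c0c ac cm]] := join_ex sc0 (f_cov apos) c0a c0p pm aw wm.
  have cp : c <> p by move=> E; apply: ap; rewrite -E.
  have zc := zmin_m c cm cp.
  have c00 := cov_pos c0c.
  (* As [z] precedes [c], [f z] precedes [c0]; [meet_order] then puts [f y'] before [f a], the
     reverse of [lt]. *)
  have yc0 : r (f z) <= r c0.
    by apply: leq_trans (f_min c0c); apply: f_mono => //; order_lia.
  have ncy : f z <> c0.
    move=> E; apply: ne; rewrite -E in sc0.
    exact: (meet_uniq sc0 sx ty tx).
  have := meet_order FT pK xp yp c0p (nesym yx) (nesym c0x) ncy tx ty sx sc0
    (r_lt yc0 ncy); order_lia.
have ya : f z <> a by move=> E; apply: ap; rewrite -E.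
have ta : cov (f y') a by rewrite -st f_cov.
(* This join is the last vertex of the lower configuration, in which [f y'], [f z], [a], [y'], [z],
   [c] replace [x], [p], [w], [w'], [v], [m]. *)
have [c [yc ac cm]] := join_ex ty ta ya yp pm aw wm.
have cp : c <> p by move=> E; apply: ap; rewrite -E.
have zc := zmin_m c cm cp.
have c0 := cov_pos yc.
have fc : f c = f z.
  by apply: f_unique_min => //; apply: f_mono => //; order_lia.
apply: (IH (l z) _ (f y') (f z) a y' z c) => //; try order_lia.
exact: f_cov.
Qed.

(** If [f v'] were not below [f u], completing the cube from [f w'] to [u] would produce the
    configuration excluded by [no_inversion]. *)
Lemma parents_cover_all K : parents_cover K.
Proof.
elim: K => [p q|K FT u v' uK v'u v'0].
  by rewrite leqn0 => /eqP p0 /cov_l; rewrite p0.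
have u0 := cov_pos v'u; have vu := f_cov u0.
have wv' := f_cov v'0.
case: (altP (f u =P v')) => [->//|/eqP nv].
have v0 := cov_pos2 vu v'u nv.
have [w' w'v w'v'] := meet_ex vu v'u nv.
case: (altP (f v' =P w')) => [->//|/eqP nw].
case: (altP (f (f u) =P f v')) => [<-|/eqP nw2]; first exact: f_cov.
case: (boolP (cov (f v') (f u))) => // nwv; exfalso.
have vv' : r (f u) < r v' by apply: r_lt => //; apply: f_min.
have w2w : r (f (f u)) < r (f v').
  by apply: r_lt => //; apply: f_mono => //; order_lia.
have ww' : r (f v') < r w' by apply: r_lt => //; apply: f_min.
have w0 := cov_pos2 wv' w'v' nw.
have w'0 := cov_pos2 w'v' wv' (nesym nw).
have lev0 := cov_l v'u.
have lev1 := cov_l vu.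
have lev2 := cov_l wv'.
have xw2 : cov (f w') (f (f u)) by apply: FT => //; order_lia.
have xw : cov (f w') (f v') by apply: FT => //; order_lia.
have [m [wm w2m mu]] := join_ex xw xw2 (nesym nw2) wv' v'u (f_cov v0) vu.
have m0 := cov_pos wm; have levm := cov_l mu.
have vm : r (f u) < r m.
  by apply: r_lt (f_min mu) _ => E; move: nwv; rewrite E wm.
have fm : f m = f (f u).
  by apply: f_unique_min => //; apply: f_mono => //; order_lia.
(* Both vertices lie below [f v'] and below [f m], which is [f (f u)]. *)
have fw : f (f v') = f w'.
  apply: (meet_uniq (f_cov w0) _ xw xw2 (nesym nw2)).
  by rewrite -fm; apply: FT => //; order_lia.
apply: (@no_inversion K (f w') (f (f u)) (f v') w' (f u) m) => //; try order_lia.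
- exact: f_cov.
- by move=> E; rewrite E in w2w; order_lia.
Qed.

End GradedOrder.

(** * Distances in median graphs *)

Section Distance.
Variables (T : finType) (e : rel T).
Hypotheses (e_sym : symmetric e) (e_irr : irreflexive e)
  (e_conn : connected_graph e).
Local Notation d := (dist e).

Lemma has_walkP x y n :
  reflect (exists p, [/\ path e x p, last x p = y & size p = n])
          (has_walk e x y n).
Proof.
apply: (iffP existsP) => [[p /andP[xp /eqP xy]]|[p [xp xy sp]]].
  by exists p; rewrite size_tuple.
by exists (Tuple (introT eqP sp)); rewrite /= xp xy eqxx.
Qed.

Lemma dist_leq x y n : has_walk e x y n -> d x y <= n.
Proof.
(* For [n] at least [#|T|] the bound is automatic, since [find] never exceeds the length of the
   searched list. *)
move=> w; case: (ltnP n #|T|) => [nT|Tn]; last first.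
  by apply: leq_trans Tn; rewrite -[X in _ <= X](size_iota 0) find_size.
case: leqP => // lt; have := before_find 0 lt.
by rewrite nth_iota // add0n w.
Qed.

Lemma has_walk_dist x y : has_walk e x y (d x y).
Proof.
have ex : has (has_walk e x y) (iota 0 #|T|).
  have /connectP[p0 xp0 ->] := e_conn x y.
  (* A duplicate-free walk has fewer than [#|T|] edges, so its length lies in the searched range. *)
  case/shortenP: xp0 => p xp up _.
  apply/hasP; exists (size p); last by apply/has_walkP; exists p.
  by rewrite mem_iota /= add0n -[_.+1]/(size (x :: p)) -(card_uniqP up) max_card.
have := nth_find 0 ex; rewrite nth_iota ?add0n //.
by rewrite -[X in _ < X](size_iota 0) -has_find.
Qed.

Lemma dist_triangle y x z : d x z <= d x y + d y z.
Proof.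
apply: dist_leq; apply/has_walkP.
have /has_walkP[p [xp xy <-]] := has_walk_dist x y.
have /has_walkP[q [yq yz <-]] := has_walk_dist y z.
by exists (p ++ q); rewrite cat_path last_cat size_cat xy xp yq yz.
Qed.

Lemma dist_sym x y : d x y = d y x.
Proof.
suff le a b : d a b <= d b a by apply/eqP; rewrite eqn_leq !le.
apply: dist_leq; apply/has_walkP.
have /has_walkP[p [bp ba <-]] := has_walk_dist b a.
exists (rev (belast b p)); rewrite size_rev size_belast; split=> //.
  rewrite -ba rev_path (eq_path (e' := e)) // => u v; exact: e_sym.
rewrite -ba; case: p {bp ba} => //= c p.
by rewrite rev_cons last_rcons.
Qed.

Lemma dist0 x y : d x y = 0 -> x = y.
Proof.
by have /has_walkP[p [_ <- sp]] := has_walk_dist x y; rewrite -sp; case: p {sp}.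
Qed.

Lemma distxx x : d x x = 0.
Proof.
apply/eqP; rewrite -leqn0; apply: dist_leq; apply/has_walkP.
by exists [::].
Qed.

Lemma dist1 x y : (d x y == 1) = e x y.
Proof.
apply/eqP/idP => [xy|xy].
  have /has_walkP[p [xp py sp]] := has_walk_dist x y.
  by move: xp py sp; rewrite xy; case: p => [|a []] //= /andP[xa _] <-.
have le : d x y <= 1.
  by apply: dist_leq; apply/has_walkP; exists [:: y]; rewrite /= xy.
case E: (d x y) le => [|[|n]] //.
by move: xy; rewrite (dist0 E) e_irr.
Qed.

Lemma dist_predecessor x y n : d x y = n.+1 -> exists2 z, e z y & d x z = n.
Proof.
move=> dn; have /has_walkP[p [xp xy sp]] := has_walk_dist x y.
case/lastP: p xp xy sp => [|p z]; rewrite dn //.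
rewrite rcons_path last_rcons size_rcons => /andP[xp ez] zy [sp].
rewrite zy in ez; exists (last x p) => //.
have le : d x (last x p) <= n by apply: dist_leq; apply/has_walkP; exists p.
have /eqP e1 : d (last x p) y == 1 by rewrite dist1.
have := dist_triangle (last x p) x y; lia.
Qed.

(** * Levels, squares and cubes in a median graph *)

Hypothesis e_median : median_graph e.

Lemma median_ex x y z : exists m, [/\ d x m + d m y = d x y,
  d y m + d m z = d y z & d z m + d m x = d z x].
Proof.
have /eqP/cards1P[m E] := e_median x y z.
have : m \in [set m] by rewrite set11.
by rewrite -E !inE => /andP[/andP[/eqP ? /eqP ?] /eqP ?]; exists m.
Qed.

Lemma median_uniq x y z a b :
  d x a + d a y = d x y -> d y a + d a z = d y z -> d z a + d a x = d z x ->
  d x b + d b y = d x y -> d y b + d b z = d y z -> d z b + d b x = d z x ->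
  a = b.
Proof.
move=> a1 a2 a3 b1 b2 b3.
have /eqP/cards1P[m E] := e_median x y z.
have : a \in [set m] by rewrite -E !inE a1 a2 a3 !eqxx.
have : b \in [set m] by rewrite -E !inE b1 b2 b3 !eqxx.
by rewrite !inE => /eqP-> /eqP->.
Qed.

Variable v0 : T.
Local Notation l := (d v0).
Definition covers (a b : T) := e a b && (l b == (l a).+1).
Local Notation cov := covers.

Lemma covers_dist a b : cov a b -> d a b = 1 /\ d b a = 1.
Proof.
by case/andP => ab _; split; apply/eqP; rewrite dist1 // e_sym.
Qed.

Lemma covers_level a b : cov a b -> l b = (l a).+1.
Proof. by case/andP => _ /eqP. Qed.

(** The median of [v0], [a] and [b] is an end of the edge, so the other end is one step further from
    [v0]. *)
Lemma edge_covers a b : e a b -> cov a b || cov b a.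
Proof.
move=> ab; rewrite /covers ab e_sym ab /=.
have ab1 : d a b = 1 by apply/eqP; rewrite dist1.
have := dist_sym a b; have := dist_triangle a v0 b; have := dist_triangle b v0 a.
have [m [h1 h2 h3]] := median_ex v0 a b.
have := dist_sym m v0; have := dist_sym b v0.
have := dist_sym m a; have := dist_sym m b.
case E: (d a m) => [|k]; lia.
Qed.

Lemma dist_same_level a b t : l a = l b -> a <> b -> e a t -> e t b ->
  d a b = 2.
Proof.
move=> ll ne at_ tb.
have a1 : d a t = 1 by apply/eqP; rewrite dist1.
have b1 : d t b = 1 by apply/eqP; rewrite dist1.
have := dist_triangle t a b; rewrite a1 b1.
case E: (d a b) => [|[|[|k]]] // _; first by case: ne; apply: dist0.
have ab : e a b by rewrite -dist1 E.
by have /orP[] := edge_covers ab => /covers_level; lia.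
Qed.

Lemma covers_dist2_up t p q : cov t p -> cov t q -> p <> q -> d p q = 2.
Proof.
move=> tp tq ne; apply: (dist_same_level _ ne (t := t)).
- by rewrite (covers_level tp) (covers_level tq).
- by rewrite e_sym; case/andP: tp.
- by case/andP: tq.
Qed.

Lemma covers_dist2_down u p q : cov p u -> cov q u -> p <> q -> d p q = 2.
Proof.
move=> pu qu ne; apply: (dist_same_level _ ne (t := u)).
- by have := covers_level pu; have := covers_level qu; lia.
- by case/andP: pu.
- by rewrite e_sym; case/andP: qu.
Qed.

(** The median of [p], [q] and [v0] works: as [p] and [q] have the same level and distance 2, it is
    adjacent to both. *)
Lemma covers_meet_ex p q u : cov p u -> cov q u -> p <> q ->
  exists2 t, cov t p & cov t q.
Proof.
move=> pu qu ne.
have pq := covers_dist2_down pu qu ne.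
have lp := covers_level pu; have lq := covers_level qu.
have [m [h1 h2 h3]] := median_ex p q v0.
have s1 := dist_sym m v0; have s2 := dist_sym m p; have s3 := dist_sym m q.
have s4 := dist_sym q v0.
by exists m; rewrite /covers -dist1; lia.
Qed.

(** Both [a] and [b] are medians of [p], [q] and [v0]. *)
Lemma covers_meet_uniq p q a b : cov a p -> cov a q -> cov b p -> cov b q ->
  p <> q -> a = b.
Proof.
move=> ap aq bp bq ne.
have pq := covers_dist2_up ap aq ne.
have [? ?] := covers_dist ap; have [? ?] := covers_dist aq.
have [? ?] := covers_dist bp; have [? ?] := covers_dist bq.
have := (covers_level ap, covers_level aq, covers_level bp, covers_level bq).
case=> [[[? ?] ?] ?].
by apply: (@median_uniq p q v0) => //; rewrite ?(dist_sym _ v0); lia.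
Qed.

(** Otherwise [t] and [v] would both be medians of [p], [q] and [z], although their levels differ by
    two. *)
Lemma covers_noK23 t v p q z : cov t p -> cov t q -> cov t z ->
  cov p v -> cov q v -> cov z v -> p <> q -> q <> z -> p <> z -> False.
Proof.
move=> tp tq tz pv qv zv pq qz pz.
have d1 := covers_dist2_up tp tq pq.
have d2 := covers_dist2_up tq tz qz.
have d3 := covers_dist2_up tz tp (nesym pz).
have [? ?] := covers_dist tp; have [? ?] := covers_dist tq.
have [? ?] := covers_dist tz; have [? ?] := covers_dist pv.
have [? ?] := covers_dist qv; have [? ?] := covers_dist zv.
have E : t = v by apply: (@median_uniq p q z); order_lia.
have := covers_level tp; have := covers_level pv; rewrite E; lia.
Qed.

Lemma covers_dist_chain a b c : cov a b -> cov b c -> d a c = 2.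
Proof.
move=> ab bc; have [? ?] := covers_dist ab; have [? ?] := covers_dist bc.
have := covers_level ab; have := covers_level bc.
have := dist_triangle b a c; have := dist_triangle a v0 c; lia.
Qed.

(** The vertices [p], [q] and [u] are pairwise at distance 2, so their median is adjacent to all
    three. *)
Lemma covers_join_ex t p q p1 q1 u : cov t p -> cov t q -> p <> q ->
  cov p p1 -> cov p1 u -> cov q q1 -> cov q1 u ->
  exists m, [/\ cov p m, cov q m & cov m u].
Proof.
move=> tp tq ne pp1 p1u qq1 q1u.
have pq := covers_dist2_up tp tq ne.
have pu := covers_dist_chain pp1 p1u; have qu := covers_dist_chain qq1 q1u.
have [m [h1 h2 h3]] := median_ex p q u.
have := (dist_sym m p, dist_sym m q, dist_sym m u, dist_sym p u).
case=> [[[s1 s2] s3] s4].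
have pm : e p m by rewrite -dist1; order_lia.
have qm : e q m by rewrite -dist1; order_lia.
have mu : e m u by rewrite -dist1; order_lia.
have := (covers_level pp1, covers_level p1u, covers_level qq1, covers_level q1u).
case=> [[[? ?] ?] ?].
(* [m] is adjacent to [p] and to [u], which are two levels apart, so it lies on the level between
   them. *)
have lm : l m = (l p).+1.
  have := edge_covers mu; have := edge_covers pm.
  by case/orP => /covers_level ?; case/orP => /covers_level ?; order_lia.
by exists m; rewrite /covers pm qm mu /=; split; order_lia.
Qed.

End Distance.

(** * Invariants of a LexBFS run *)

Section Run.
Variables (T : finType) (e : rel T) (v0 : T).
Local Notation on := (ordered_neighbors e).

Lemma lex_visit_split s c1 x c2 y : lex_visit e s (c1 ++ x :: c2) -> y \in c2 ->
  lex_le (on (s ++ c1) x) (on (s ++ c1) y).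
Proof.
elim: c1 s => [|a c1 IH] s /= /andP[h1 h2] yc.
  by rewrite cats0; apply: (allP h1).
by have := IH _ h2 yc; rewrite cat_rcons.
Qed.

Lemma lex_visit_index s c x y : lex_visit e s c -> y \in c ->
  index x c < index y c ->
  lex_le (on (s ++ take (index x c) c) x) (on (s ++ take (index x c) c) y).
Proof.
move=> vis yc lt.
have ltc : index x c < size c by apply: leq_trans lt (index_size _ _).
have Ec := cat_take_drop (index x c) c.
rewrite (drop_nth x ltc) nth_index in Ec; last by rewrite -index_mem.
apply: (@lex_visit_split s _ x (drop (index x c).+1 c)); first by rewrite Ec.
have := yc; rewrite -{1}Ec mem_cat inE => /or3P[yt|/eqP yx|//].
  by move: (lt); rewrite ltnNge ltnW // (index_ltn yt).
by rewrite yx ltnn in lt.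
Qed.

(* [d] lists the vertices already removed from the queue. *)
Record bfs_invariant (d q s : seq T) (f : T -> T) : Prop := BFSInvariant {
  queue_cat : s = d ++ q;
  order_uniq : uniq s;
  order_head : exists s', s = v0 :: s';
  dequeued_closed : forall x y, x \in d -> e x y -> y \in s;
  parent_edge : forall x, x \in s -> x != v0 -> e (f x) x;
  parent_dequeued : forall x, x \in s -> x != v0 -> f x \in d;
  parent_min : forall x y, x \in s -> x != v0 -> e y x ->
    index (f x) s <= index y s;
  parent_mono : forall x y, x \in s -> x != v0 -> y \in s -> y != v0 ->
    index x s <= index y s -> index (f x) s <= index (f y) s;
  sibling_lex : forall x y, x \in s -> x != v0 -> y \in s -> y != v0 ->
    f x = f y -> index x s < index y s ->
    lex_le (on (take (index x s) s) x) (on (take (index x s) s) y) }.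

(** Vertices of [c] get the parent [u], which comes after all previously dequeued vertices and so
    after all older parents. Hence parents stay ordered, and no old vertex becomes a sibling of a
    new one. *)
Lemma bfs_invariant_step d u q s c (f : {ffun T -> T}) :
  bfs_invariant d (u :: q) s f ->
  perm_eq c (enum [pred v | e u v & v \notin s]) ->
  lex_visit e s c ->
  bfs_invariant (rcons d u) (q ++ c) (s ++ c)
    [ffun v => if v \in c then u else f v].
Proof.
case=> sE us [s' s0] cl fe fd fm fr fl pc vis.
have mc x : (x \in c) = e u x && (x \notin s).
  by rewrite (perm_mem pc) mem_enum inE.
have uc : uniq c by rewrite (perm_uniq pc) enum_uniq.
have ns x : x \in s -> x \in c = false by move=> xs; rewrite mc xs andbF.
have us_ : u \in s by rewrite sE mem_cat mem_head orbT.
have ds x : x \in d -> x \in s by rewrite sE mem_cat => ->.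
have iu : index u s = size d.
  move: us; rewrite sE cat_uniq => /and3P[_ /hasPn/(_ u (mem_head _ _)) ud _].
  by rewrite index_cat (negPf ud) /= eqxx addn0.
have id x : x \in d -> index x s < index u s.
  by move=> xd; rewrite iu sE index_cat xd index_mem.
have ia x : x \in s -> index x (s ++ c) = index x s.
  by move=> xs; rewrite index_cat xs.
have ib x : x \notin s -> index x (s ++ c) = size s + index x c.
  by move=> xs; rewrite index_cat (negPf xs).
have ile x : index x s <= index x (s ++ c).
  rewrite index_cat; case: ifP => // _; apply: leq_trans (index_size _ _) _.
  exact: leq_addr.
have il x : x \in s -> index x s < size s by rewrite index_mem.
have new x : x \in s ++ c -> x \notin s -> x \in c.
  by rewrite mem_cat => /orP[->|].
split.
- by rewrite sE cat_rcons -catA.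
- rewrite cat_uniq us uc andbT; apply/hasPn => x; rewrite mc.
  by case/andP.
- by exists (s' ++ c); rewrite s0.
- move=> x y; rewrite mem_rcons inE => /predU1P[->|xd] xy; last first.
    by rewrite mem_cat (cl x y).
  by rewrite mem_cat mc xy; case: (y \in s).
- move=> x xs x0; rewrite ffunE; case: ifP => xc.
    by move: xc; rewrite mc; case/andP.
  by apply: fe => //; move: xs; rewrite mem_cat xc orbF.
- move=> x xs x0; rewrite ffunE mem_rcons inE.
  case: ifP => xc; first by rewrite eqxx.
  by rewrite fd ?orbT //; move: xs; rewrite mem_cat xc orbF.
- move=> x y xs x0 yx; rewrite ffunE; case: ifP => xc; last first.
    have xs' : x \in s by move: xs; rewrite mem_cat xc orbF.
    rewrite ia; first by apply: leq_trans (fm _ _ xs' x0 yx) (ile y).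
    exact: ds (fd _ xs' x0).
  (* A neighbor [y] before [u] would already be dequeued, and closure would put [x] in [s]. *)
  rewrite ia //; apply: leq_trans (ile y); rewrite leqNgt; apply/negP => lt.
  have yd : y \in d.
    by move: lt; rewrite iu sE index_cat; case: ifP => // _; rewrite ltnNge leq_addr.
  by move: xc; rewrite mc (cl _ _ yd yx) andbF.
- move=> x y xs x0 ys y0 le; rewrite !ffunE.
  case: (boolP (x \in s)) => xs'; last first.
    have xc := new x xs xs'; rewrite xc; case: (boolP (y \in s)) => ys'.
      by move: le; rewrite (ib x xs') (ia y ys') leqNgt ltn_addr ?il.
    by rewrite (new y ys ys').
  rewrite (ns _ xs'); have fxd := fd _ xs' x0; rewrite (ia (f x)) ?ds //.
  case: (boolP (y \in s)) => ys'; last first.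
    by rewrite (new y ys ys') (ia u) // ltnW // id.
  rewrite (ns _ ys') (ia (f y)) ?ds ?fd //; apply: fr => //.
  by rewrite -(ia x) // -(ia y).
- move=> x y xs x0 ys y0; rewrite !ffunE.
  have nfu z : z \in s -> z != v0 -> f z <> u.
    by move=> zs z0 E; have := id _ (fd _ zs z0); rewrite E ltnn.
  case: (boolP (x \in s)) => xs'.
    rewrite (ns _ xs'); case: (boolP (y \in s)) => ys'; last first.
      by rewrite (new y ys ys') => /nfu; case.
    rewrite (ns _ ys') (ia x) // (ia y) // => E lt.
    by rewrite takel_cat ?index_size //; apply: fl.
  have xc := new x xs xs'; rewrite xc.
  case: (boolP (y \in s)) => ys'.
    by rewrite (ns _ ys') => /esym/nfu; case.
  have yc := new y ys ys'; rewrite yc (ib x) // (ib y) // => _ lt.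
  have -> : take (size s + index x c) (s ++ c) = s ++ take (index x c) c.
    by rewrite take_cat ltnNge leq_addr /= addKn.
  by apply: lex_visit_index => //; rewrite -(ltn_add2l (size s)).
Qed.

Lemma lexbfs_state_invariant q s f : lexbfs_state e v0 q s f ->
  exists d, bfs_invariant d q s f.
Proof.
elim=> {q s f} [f|u q s c f _ [d inv] pc vis]; last first.
  by exists (rcons d u); apply: bfs_invariant_step.
exists [::]; split=> //=; first by exists [::].
1,2: by move=> x; rewrite inE => /eqP->; rewrite eqxx.
all: by move=> x y; rewrite inE => /eqP->; rewrite eqxx.
Qed.

(** Once the queue is empty, the ordered vertices are closed under adjacency, and connectedness
    makes them all of [T]. *)
Lemma lexbfs_ordering_all s f : connected_graph e -> lexbfs_ordering e v0 s f ->
  bfs_invariant s [::] s f /\ forall x, x \in s.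
Proof.
move=> conn /lexbfs_state_invariant[d inv].
have ds : s = d by rewrite (queue_cat inv) cats0.
rewrite -ds in inv; split=> // x; have [s' s0] := order_head inv.
have /connectP[p] := conn v0 x.
have : v0 \in s by rewrite s0 mem_head.
elim: p {s0} (v0) => [|a p IH] w ws /=; first by move=> _ ->.
by case/andP => wa; apply: IH; apply: (dequeued_closed inv ws).
Qed.

(** Both lists start with [i]. As [B] continues, so must [A], because [lex_le] ranks a list after
    its proper extensions; the second entry of [A] is then at most that of [B]. *)
Lemma lex_le_second (A B : seq nat) i b : sorted ltn A -> sorted ltn B ->
  i \in A -> i \in B -> (forall j, j \in A -> i <= j) ->
  (forall j, j \in B -> i <= j) -> lex_le A B -> b \in B -> b != i ->
  exists a, [/\ a \in A, a != i & a <= b].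
Proof.
have hd D : sorted ltn D -> i \in D -> (forall j, j \in D -> i <= j) ->
    exists D', D = i :: D'.
  case: D => // j D; rewrite /= (path_sortedE ltn_trans) inE => /andP[/allP lt _].
  move=> /predU1P[->|iD] le; first by exists D.
  by have := le j (mem_head _ _); rewrite leqNgt (lt i iD).
move=> sA sB iA iB mA mB; have [A' EA] := hd A sA iA mA.
have [B' EB] := hd B sB iB mB; rewrite {A iA mA}EA in sA *.
rewrite {B iB mB hd}EB in sB *; rewrite /= ltnn eqxx inE /= => AB.
case/predU1P => [->|bB]; first by rewrite eqxx.
move=> _; case: B' bB sB AB => // j B' bB /= /andP[_ pB].
have jb : j <= b.
  move: bB pB; rewrite inE (path_sortedE ltn_trans) => /predU1P[->//|bB].
  by case/andP => /allP/(_ b bB)/ltnW.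
case: A' sA => //= a A' /andP[ia _] le; exists a; split.
- by rewrite !inE eqxx orbT.
- by rewrite gtn_eqF.
- by apply: leq_trans jb; case/orP: le => [/ltnW|/andP[/eqP->]].
Qed.

Lemma ordered_neighbors_sorted s v : uniq s -> sorted ltn (on s v).
Proof.
move=> us; rewrite /ordered_neighbors sorted_map.
apply: (sorted_filter (leT := relpre (index^~ s) ltn)).
  by move=> ? ? ?; apply: ltn_trans.
rewrite -sorted_map; have -> : map (index^~ s) s = iota 0 (size s).
  by apply: (@eq_from_nth _ 0) => [|i]; rewrite size_map ?size_iota // => i_s;
    rewrite nth_iota // (nth_map v) // index_uniq.
exact: iota_ltn_sorted.
Qed.

Lemma ordered_neighbors_takeP k s v i :
  reflect (exists w, [/\ w \in s, index w s < k, e w v & i = index w s])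
          (i \in on (take k s) v).
Proof.
have take_index w : w \in take k s -> index w (take k s) = index w s.
  by move=> wt; rewrite -{2}(cat_take_drop k s) index_cat wt.
apply: (iffP mapP) => [[w]|[w [ws wk wv ->]]].
  rewrite mem_filter => /andP[wv wt] ->; exists w; rewrite take_index //.
  by have ws := mem_take wt; rewrite -in_take.
have wt : w \in take k s by rewrite in_take.
by exists w; rewrite ?mem_filter ?wv ?take_index.
Qed.
End Run.

(** * LexBFS orderings of median graphs *)

Section ParentProperties.
Variables (T : finType) (e : rel T).
Hypotheses (e_sym : symmetric e) (e_irr : irreflexive e)
  (e_conn : connected_graph e) (e_median : median_graph e).
Variables (v0 : T) (s : seq T) (f : T -> T).
Hypotheses (inv : bfs_invariant e v0 s [::] s f) (s_all : forall x, x \in s).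
Local Notation l := (dist e v0).
Local Notation r := (index^~ s).

Lemma index_order_inj : injective r.
Proof.
by move=> x y E; rewrite -(nth_index v0 (s_all x)) E nth_index.
Qed.

Lemma level_gt0 v : (0 < l v) = (v != v0).
Proof.
rewrite lt0n; congr (~~ _); apply/eqP/eqP => [/(dist0 e_conn)->//|->].
exact: distxx.
Qed.

(** For a neighbor [v1] one level below [v], monotonicity and minimality of parents put [f w] no
    later than [v1]; induction bounds the level of [f w], and [w] is one step away. *)
Lemma order_level v w : index w s <= index v s -> l w <= l v.
Proof.
move en: (l v) => n; elim: n v w en => [|n IH] v w en le.
  have v_v0 := dist0 e_conn en; have [s' s0] := order_head inv.
  move: le; rewrite -v_v0 s0 /= eqxx leqn0; case: (eqVneq v0 w) => // <- _.
  by rewrite distxx.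
case: (eqVneq w v0) => [->|w0]; first by rewrite distxx.
have v_0 : v != v0 by rewrite -level_gt0 en.
have [v1 v1v l1] := dist_predecessor e_irr e_conn en.
have le1 : l (f w) <= n.
  apply: IH l1 _.
  apply: leq_trans (parent_mono inv (s_all w) w0 (s_all v) v_0 le) _.
  exact: (parent_min inv (s_all v) v_0 v1v).
have := dist_triangle e_conn (f w) v0 w.
have /eqP-> : dist e (f w) w == 1.
  by rewrite dist1 // (parent_edge inv).
by rewrite addn1 => /leq_trans; apply.
Qed.

(** The parent is no later than some neighbor one level below [v], so [order_level] makes the edge
    go up. *)
Lemma parent_covers v : 0 < l v -> covers e v0 (f v) v.
Proof.
move=> v_gt0; have v_0 := v_gt0; rewrite level_gt0 in v_0.
have [v1 v1v l1] := dist_predecessor e_irr e_conn (esym (prednK v_gt0)).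
have := order_level (parent_min inv (s_all v) v_0 v1v).
have := parent_edge inv (s_all v) v_0.
move/(edge_covers e_sym e_irr e_conn e_median v0)/orP => [//|].
by move/covers_level; lia.
Qed.

(** [lex_le_second] is applied to the lists of [v] and [w] at the moment [v] is chosen; the common
    parent heads both. *)
Lemma sibling_second v w b : 0 < l v -> 0 < l w -> f v = f w ->
  index v s < index w s -> covers e v0 b w -> b <> f w ->
  exists a, [/\ covers e v0 a v, a <> f v & index a s <= index b s].
Proof.
move=> v_gt0 w_gt0 fvw lt bw bf.
have [v_0 w_0] : v != v0 /\ w != v0 by rewrite -!level_gt0.
have us := order_uniq inv.
have fv : covers e v0 (f v) v := parent_covers v_gt0.
have fw : covers e v0 (f v) w by rewrite fvw parent_covers.
have fmin x y : 0 < l x -> e y x -> index (f x) s <= index y s.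
  by rewrite level_gt0 => x0; apply: (parent_min inv).
have before a x : 0 < l x -> index (f a) s < index (f x) s -> a != v0 ->
    index a s < index x s.
  rewrite level_gt0 => x0 fax a0; rewrite ltnNge; apply/negP.
  by move/(parent_mono inv (s_all x) x0 (s_all a) a0); rewrite leqNgt fax.
have ltl a x : covers e v0 a x -> index a s < index x s.
  move=> ax; rewrite ltnNge; apply/negP => /order_level.
  by rewrite (covers_level ax) ltnn.
(* The list of [w] at that moment must already contain [b]. Unless [b] is [v0], its parent is one
   level below [f v], hence earlier, and so [b] precedes [v]. *)
have bv : index b s < index v s.
  case: (eqVneq b v0) => [->|b0].
    have [s' s0] := order_head inv.
    by rewrite s0 /= eqxx (eq_sym v0) (negPf v_0).
  apply: before => //; rewrite fvw.
  have fb : covers e v0 (f b) b by apply: parent_covers; rewrite level_gt0.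
  rewrite ltnNge; apply/negP => /order_level.
  have := (covers_level fb, covers_level bw).
  case; rewrite -fvw => hb; rewrite (covers_level fw) hb => -[->].
  by rewrite ltnn.
have in_on x k : e (f v) x -> index (f v) s < k ->
    index (f v) s \in ordered_neighbors e (take k s) x.
  by move=> fx kf; apply/ordered_neighbors_takeP; exists (f v).
have on_min x j : 0 < l x -> f v = f x ->
    j \in ordered_neighbors e (take (index v s) s) x -> index (f v) s <= j.
  move=> x0 -> /ordered_neighbors_takeP[y [_ _ yx ->]]; exact: fmin.
have edge x y : covers e v0 x y -> e x y by case/andP.
have [] := @lex_le_second (ordered_neighbors e (take (index v s) s) v)
  (ordered_neighbors e (take (index v s) s) w) (index (f v) s) (index b s).
- exact/ordered_neighbors_sorted/take_uniq.
- exact/ordered_neighbors_sorted/take_uniq.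
- by apply: in_on; [apply: edge | apply: ltl].
- by apply: in_on; [apply: edge | apply: ltl].
- by move=> j; apply: on_min.
- by move=> j; apply: on_min.
- by apply: (sibling_lex inv).
- by apply/ordered_neighbors_takeP; exists b; rewrite edge.
- by apply/eqP => /index_order_inj; rewrite fvw.
move=> i [/ordered_neighbors_takeP[a [_ av ea ->]] /eqP ne le].
exists a; split=> //; last by move=> E; apply: ne; rewrite E.
(* Since [a] precedes [v], the edge cannot go up from [v] to [a]. *)
have := edge_covers e_sym e_irr e_conn e_median v0 ea; case/orP => // va.
by have := ltl _ _ va; rewrite ltnNge ltnW.
Qed.

Lemma parents_adjacent p q : covers e v0 q p -> q != v0 -> e (f q) (f p).
Proof.
move=> qp; rewrite -level_gt0 => q0.
suff /andP[] : covers e v0 (f q) (f p) by [].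
apply: (@parents_cover_all T (covers e v0) l (index^~ s) f _ _ _ _ _ _ _ _ _ _ _
  (l p)) => //.
- exact: covers_level.
- by move=> a b /(dist0 e_conn) <- /(dist0 e_conn).
- exact: covers_meet_ex.
- exact: covers_meet_uniq.
- exact: covers_noK23.
- exact: covers_join_ex.
- exact: index_order_inj.
- exact: parent_covers.
- move=> x y xy; case/andP: (xy) => exy _.
  by apply: (parent_min inv) => //; rewrite -level_gt0 (covers_level xy).
- by move=> x y; rewrite !level_gt0 => x0 y0; apply: (parent_mono inv).
- exact: sibling_second.
Qed.

End ParentProperties.

Theorem theorem4p5 (T : finType) (e : rel T)
    (e_sym : symmetric e) (e_irr : irreflexive e)
    (e_conn : connected_graph e) (e_median : median_graph e)
    (v0 : T) (s : seq T) (f : {ffun T -> T})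
    (s_lexbfs : lexbfs_ordering e v0 s f)
    (u v : T) (uv : e u v) (u_neq_v0 : u != v0) (v_neq_v0 : v != v0) :
  e (f u) (f v).
Proof.
have [inv s_all] := lexbfs_ordering_all e_conn s_lexbfs.
have adj := parents_adjacent e_sym e_irr e_conn e_median inv s_all.
have /orP[cuv|cvu] := edge_covers e_sym e_irr e_conn e_median v0 uv.
  exact: adj.
by rewrite e_sym; apply: adj.
Qed.
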